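(* Let $d, q \ge 2$ be fixed integers. For every $\varepsilon > 0$, a uniformly chosen $d$-array of order \[ n = \left\lceil (1+\varepsilon)\frac{k}{e}\, q^{k^{d-1}/d} \right\rceil \] over the $q$-symbol alphabet is $k$-universal with high probability as $k \to \infty$; that is, the probability that it is $k$-universal tends to $1$ as $k\to\infty$ (with $d,q,\varepsilon$ fixed).
   Context: Let $\Sigma = [q] = \{1,\dots,q\}$ be an alphabet with $q$ symbols. For positive integers $n_1,\dots,n_d$, a $d$-array of size $(n_1,\dots,n_d)$ over $\Sigma$ is a collection of symbols $a_{\mathbf{i}} \in \Sigma$ indexed by the vectors $\mathbf{i} \in [n_1]\times\dots\times[n_d]$, where $[m]=\{1,\dots,m\}$. A $d$-array of order $n$ is a $d$-array of size $(n,n,\dots,n)$. A uniformly chosen $d$-array of order $n$ is chosen uniformly at random among all $q^{n^d}$ such arrays. The coordinate restriction operation on a $d$-array $A=(a_{\mathbf{i}})$ of size $(n_1,\dots,n_d)$ is: choose some $j\in[d]$ and $\ell\in[n_j]$, and delete all the symbols whose $j$-th coordinate is $\ell$, to obtain a $d$-array of size $(n_1,\dots,n_{j-1},n_j-1,n_{j+1},\dots,n_d)$ (with the remaining $j$-th coordinates relabelled in order). A $d$-array $A$ contains a $d$-array $A'$ if $A'$ can be obtained from $A$ by iteratively applying coordinate restriction operations. A $d$-array over $\Sigma$ is $k$-universal if it contains every $d$-array over $\Sigma$ of size $(n_1,\dots,n_d)$ with $n_j \le k$ for all $j\in[d]$ (equivalently, every $d$-array over $\Sigma$ of order $k$). Here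 $e$ is the base of the natural logarithm. *)

(* Defs.v *)
From HB Require Import structures.
From mathcomp Require Import all_boot all_order all_algebra.
From mathcomp Require Import all_classical all_reals all_analysis.

Set Implicit Arguments.
Unset Strict Implicit.
Unset Printing Implicit Defensive.

Import Order.TTheory GRing.Theory Num.Theory.
Import numFieldNormedType.Exports.

Local Open Scope classical_set_scope.
Local Open Scope ring_scope.

(* Coordinates and symbols are numbered from 0: 'I_m stands for [m]. *)
Definition array_index (d : nat) (n : 'I_d -> nat) :=
  {dffun forall j : 'I_d, 'I_(n j)}.

Definition darray (d q : nat) (n : 'I_d -> nat) := {ffun array_index n -> 'I_q}.

Definition del_size (d : nat) (n : 'I_d -> nat) (j i : 'I_d) : nat :=
  if i == j then (n i).-1 else n i.

(* The coordinate of the original array that becomes coordinate x, in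
   direction i, once the j-th coordinate l has been deleted: [lift l x] if
   i = j (the increasing enumeration of the coordinates other than l), and x
   otherwise. *)
Definition undel_coord (d : nat) (n : 'I_d -> nat) (j : 'I_d) (l : 'I_(n j))
    (i : 'I_d) : 'I_(del_size n j i) -> 'I_(n i) :=
  match i =P j as r in reflect _ b
    return 'I_(if b then (n i).-1 else n i) -> 'I_(n i) with
  | ReflectT eq_ij => lift (ecast z 'I_(n z) (esym eq_ij) l)
  | ReflectF _ => id
  end.

Lemma undel_coordE (d : nat) (n : 'I_d -> nat) (j : 'I_d) (l : 'I_(n j))
    (i : 'I_d) (x : 'I_(del_size n j i)) :
  undel_coord l x = (if i == j then bump l x else x) :> nat.
Proof.
rewrite /undel_coord; move: x; rewrite /del_size.
by case: (i =P j) => [eq_ij|//] x; move: x; case: _ / (esym eq_ij).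
Qed.

Definition coord_restrict (d q : nat) (n : 'I_d -> nat) (A : darray q n)
    (j : 'I_d) (l : 'I_(n j)) : darray q (del_size n j) :=
  [ffun x : array_index (del_size n j) =>
    A [ffun i => undel_coord l (x i)]].

Inductive contains (d q : nat) :
    forall n m : 'I_d -> nat, darray q n -> darray q m -> Prop :=
| contains_refl (n : 'I_d -> nat) (A : darray q n) : contains A A
| contains_restrict (n m : 'I_d -> nat) (A : darray q n) (j : 'I_d)
    (l : 'I_(n j)) (B : darray q m) :
    contains (coord_restrict A l) B -> contains A B.

Definition universal (d q k : nat) (n : 'I_d -> nat) (A : darray q n) : Prop :=
  forall m : 'I_d -> nat, (forall j, (0 < m j <= k)%N) ->
    forall B : darray q m, contains A B.

Definition darray_of_order (d q n : nat) : finType :=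
  darray q (fun _ : 'I_d => n).

Definition uniform_pr (R : realType) (T : finType) (E : T -> Prop) : R :=
  #|[pred x : T | `[< E x >]]|%:R / #|T|%:R.

(* The ceiling is an integer, nonnegative as soon as 0 <= eps, so that taking
   its absolute value merely casts it to nat. *)
Definition threshold_order (R : realType) (d q : nat) (eps : R) (k : nat) : nat :=
  `|Num.ceil ((1 + eps) * (k%:R / expR 1)
      * (q%:R `^ ((k ^ d.-1)%:R / d%:R)))|%N.

(* Main.v *)
Require Import Defs.
From HB Require Import structures.
From mathcomp Require Import all_boot all_order all_algebra perm.
From mathcomp Require Import all_classical all_reals all_analysis.
From mathcomp Require Import ring lra zify.

Set Implicit Arguments.
Unset Strict Implicit.
Unset Printing Implicit Defensive.

Import Order.TTheory GRing.Theory Num.Theory.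
Import numFieldNormedType.Exports.

Import mathcomp.boot.finset.

Local Open Scope set_scope.
Local Open Scope ring_scope.

(** Fix a pattern B of order k. A choice of k coordinates in every direction
    selects a box of k^d cells of the random array, and the box carries B with
    probability p = q^(-k^d). Write Q = q^(k^(d-1)/d), so that Q^(kd) = q^(k^d).
    Since 'C(n, k) is about (e n / k)^k, the expected number of boxes carrying B
    is about ((1 + eps) Q)^(kd) p = (1 + eps)^(kd), up to a polynomial factor in
    k: exponentially large in k. There are only q^(k^d) patterns, so it suffices
    that B is missed with probability at most exp(- mu / 2), where mu is the
    expected number of boxes carrying B; a union bound over B concludes.

    Such a bound is of Janson type. As q symbols are involved, the events are not
    monotone, and a correlation inequality is replaced by the local lemma, in the
    manner of Suen's inequality ([avoid_all_le]). Each box meets few others, in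
    the sense that the total probability of the events it meets is small, so
    imposing that a neighbourhood of events does not occur costs a factor at most
    2. Hence each event, conditionally on none of the previous ones occurring,
    still has probability at least p/2. The hypothesis of this sieve is that,
    given that a box S carries B, the expected number of other boxes meeting S
    that carry B is at most 1/16.

    This expectation is a sum over boxes T of q^(prod l_j - k^d), where l_j is the
    number of coordinates common to S and T in direction j ([overlap_sum]). The
    number of T with given l_j is about Q^(sum (k - l_j)), so the exponent of q to
    be controlled is, with x_j = l_j / k, k^d times prod x_j - avg x_j. By the
    inequality of the means prod x_j <= (avg x)^2, so that avg x - prod x_j is
    at least half of min(avg x, 1 - avg x) ([overlap_weight]). The two cases of
    the minimum give weights that factor over the directions, and each resulting
    one-dimensional sum is small ([small_overlap_bound], [large_overlap_bound]).
    These estimates need (1 + eps)^k not to exceed a small power of Q, which is no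
    restriction: only boxes in the first w coordinates are used, with w the order
    that corresponds to a smaller eps. *)

(** * A sieve for weakly dependent events *)

Definition avoid (T I : finType) (E : I -> {set T}) (J : {set I}) : {set T} :=
  [set x | [forall j in J, x \notin E j]].

Section Sieve.
Variables (R : realFieldType) (T I : finType) (E : I -> {set T}).
Local Notation m B := (#|B : {set T}|%:R : R).

Lemma in_avoid (J : {set I}) x :
  reflect (forall j, j \in J -> x \notin E j) (x \in avoid E J).
Proof. by rewrite inE; apply: (iffP forall_inP). Qed.

Lemma avoid0 : avoid E set0 = [set: T]%SET.
Proof. by apply/setP => x; rewrite in_setT; apply/in_avoid => j; rewrite in_set0. Qed.

Lemma avoidU (J K : {set I}) :
  avoid E (J :|: K) = avoid E J :&: avoid E K.
Proof.
apply/setP => x; rewrite in_setI; apply/in_avoid/andP.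
  by move=> h; split; apply/in_avoid => j hj; apply: h; rewrite in_setU hj ?orbT.
by case=> /in_avoid hJ /in_avoid hK j; rewrite in_setU => /orP[/hJ|/hK].
Qed.

Lemma avoidS (J K : {set I}) : J \subset K -> avoid E K \subset avoid E J.
Proof.
move=> /fintype.subsetP sJK; apply/fintype.subsetP => x /in_avoid h.
by apply/in_avoid => j /sJK /h.
Qed.

Lemma le_measure (A B : {set T}) : A \subset B -> m A <= m B.
Proof. by move=> sAB; rewrite ler_nat subset_leq_card. Qed.

Lemma measure_union_bound (J : {set I}) (B : {set T}) :
  m B <= m (B :&: avoid E J) + \sum_(j in J) m (E j :&: B).
Proof.
rewrite -natr_sum -natrD ler_nat.
have -> : #|B| = (#|B :&: avoid E J| + #|B :\: avoid E J|)%N.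
  by rewrite cardsID.
rewrite leq_add2l.
have sub : B :\: avoid E J \subset \bigcup_(j in J) (E j :&: B).
  apply/fintype.subsetP => x; rewrite !inE negb_forall_in => /andP[/exists_inP[j jJ]].
  rewrite negbK => xE xB; apply/bigcupP; exists j => //; by rewrite inE xE.
apply: leq_trans (subset_leq_card sub) _.
elim/big_rec2: _ => [|j y z _ le]; first by rewrite cards0.
by apply: leq_trans (leq_card_setU _ _) _; rewrite leq_add2l.
Qed.

(** The cardinality plays the role of an unnormalised uniform probability. Every
    event has probability p; [w i j] bounds the conditional probability of [E j]
    given [E i], even if moreover events adjacent to neither are avoided. *)
Variables (adj : rel I) (p : R) (w : I -> I -> R).
Hypothesis adj_refl : reflexive adj.
Hypothesis p_ge0 : 0 <= p.
Hypothesis p_small : p <= 1 / 16.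
Hypothesis p_le_w : forall i j, p <= w i j.
Hypothesis w_sum : forall i, \sum_(j | adj i j && (j != i)) w i j <= 1 / 16.
Hypothesis indep : forall i (J : {set I}), (forall j, j \in J -> ~~ adj i j) ->
  m (E i :&: avoid E J) = p * m (avoid E J).
Hypothesis indep2 : forall i j (J : {set I}),
  (forall l, l \in J -> ~~ adj i l && ~~ adj j l) ->
  m (E i :&: E j :&: avoid E J) <= p * w i j * m (avoid E J).

Let nbrs (i : I) := [set j | adj i j].

Lemma degree_bound (K : {set I}) i : K \subset nbrs i ->
  \sum_(j in K) p <= 1 / 8.
Proof.
move=> /fintype.subsetP sK.
have h : \sum_(j in K) p <= \sum_(j | adj i j) p.
  rewrite [leRHS](bigID (mem K)) /=.
  rewrite [X in _ <= X + _](eq_bigl (fun j => j \in K)); last first.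
    by move=> j; case: (boolP (j \in K)) => [/sK|]; rewrite ?andbF // inE => ->.
  by rewrite lerDl sumr_ge0.
apply: le_trans h _; rewrite (bigD1 i) ?adj_refl //=.
apply: le_trans (lerD p_small (le_trans _ (w_sum i))) _.
  by apply: ler_sum => j _; exact: p_le_w.
lra.
Qed.

Lemma far_nbrs (J : {set I}) i j : j \in J :\: nbrs i -> ~~ adj i j.
Proof. by rewrite !inE => /andP[]. Qed.

Lemma avoid_split (J : {set I}) i :
  avoid E J = avoid E (J :\: nbrs i) :&: avoid E (J :&: nbrs i).
Proof. by rewrite -avoidU setUC setID. Qed.

(** The Lovasz local lemma. Both estimates feed each other along an induction on
    the number of avoided events: the neighbours of i have total probability at
    most 1/8, and each of them keeps probability at most 2p when the events far
    from i are avoided, so that avoiding them too loses at most half of the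
    measure. *)
Lemma local_lemma (J : {set I}) i :
  m (E i :&: avoid E J) <= 2 * p * m (avoid E J) /\
  m (avoid E (J :\: nbrs i)) <= 2 * m (avoid E J).
Proof.
have [n] := ubnP #|J|; elim: n => // n IHn in J i * => /ltnSE-leJn.
pose K := J :&: nbrs i; set J' := J :\: nbrs i.
have half : m (avoid E J') <= 2 * m (avoid E J).
  have [K0|[l lK]] := set_0Vmem K.
    rewrite (avoid_split J i) -/K K0 avoid0 setIT.
    by have := ler0n R #|avoid E J'|; lra.
  have ltJ : (#|J'| < n)%N.
    apply: leq_trans leJn; rewrite -(cardsID (nbrs i) J) -[X in (X < _)%N]add0n.
    by rewrite ltn_add2r; apply/card_gt0P; exists l.
  have := measure_union_bound K (avoid E J').
  rewrite -(avoid_split J i).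
  have : \sum_(j in K) m (E j :&: avoid E J') <=
         \sum_(j in K) p * (2 * m (avoid E J')).
    by apply: ler_sum => j _; have [+ _] := IHn J' j ltJ; lra.
  rewrite -mulr_suml.
  have K8 : \sum_(j in K) p <= 1 / 8 by apply: (@degree_bound _ i); apply: subsetIr.
  have : (\sum_(j in K) p) * (2 * m (avoid E J')) <= 1 / 8 * (2 * m (avoid E J')).
    by apply: ler_wpM2r => //; apply: mulr_ge0.
  have := ler0n R #|avoid E J'|.
  lra.
split=> //.
have -> : 2 * p * m (avoid E J) = p * (2 * m (avoid E J)) by ring.
apply: le_trans (ler_wpM2l p_ge0 half).
rewrite -(indep (@far_nbrs J i)); apply: le_measure.
by rewrite setIS // avoidS // subsetDl.
Qed.

(** Split J into the events N far from i and the neighbours of i. By independence,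
    E i meets [avoid E N] in measure exactly p; what is lost by avoiding the
    neighbours j as well is at most the measure of E i, E j and the events of N
    far from j, the removal of the events of N near j costing a factor 2 by the
    local lemma. *)
Lemma avoid_step (J : {set I}) i : i \notin J ->
  m (avoid E (i |: J)) <= (1 - p / 2) * m (avoid E J).
Proof.
move=> iJ; pose K := J :&: nbrs i; set N := J :\: nbrs i.
have E1 : m (avoid E J) = m (avoid E (i |: J)) + m (E i :&: avoid E J).
  rewrite -(cardsID (E i)) natrD addrC; congr (_ + _); last by rewrite setIC.
  congr (_%:R); apply: eq_card => x; rewrite in_setD.
  rewrite avoidU in_setI; congr (_ && _).
  apply/idP/in_avoid => [xE j|h]; first by rewrite inE => /eqP->.
  by apply: h; rewrite inE.
have E2 := measure_union_bound K (E i :&: avoid E N).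
rewrite -setIA -(avoid_split J i) (indep (@far_nbrs J i)) in E2.
have E3 : \sum_(j in K) m (E j :&: (E i :&: avoid E N)) <=
    \sum_(j in K) w i j * (2 * p * m (avoid E N)).
  apply: ler_sum => j _; rewrite setIA (setIC (E j)).
  apply: (@le_trans _ _ (m (E i :&: E j :&: avoid E (N :\: nbrs j)))).
    by apply: le_measure; rewrite setIS // avoidS // subsetDl.
  apply: le_trans (indep2 _) _.
    by move=> l; rewrite !inE => /andP[-> /andP[->]].
  have -> : w i j * (2 * p * m (avoid E N)) = p * w i j * (2 * m (avoid E N)) by ring.
  have [_ h] := local_lemma N j.
  by apply: ler_wpM2l => //; rewrite mulr_ge0 // (le_trans p_ge0 (p_le_w i j)).
rewrite -mulr_suml in E3.
have E4 : \sum_(j in K) w i j <= 1 / 16.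
  apply: le_trans (w_sum i); rewrite [leRHS](bigID (mem K)) /=.
  rewrite [X in _ <= X + _](eq_bigl (fun j => j \in K)); last first.
    move=> j; rewrite !inE; have [jJ|_] := boolP (j \in J); last by rewrite andbF.
    have -> : j != i by apply: contraNneq iJ => <-.
    by rewrite /= andbT andbb.
  by rewrite lerDl sumr_ge0 // => j _; apply: le_trans p_ge0 (p_le_w i j).
have E5 : m (avoid E J) <= m (avoid E N) by apply/le_measure/avoidS/subsetDl.
have pN : 0 <= p * m (avoid E N) by apply: mulr_ge0.
have : (\sum_(j in K) w i j) * (2 * p * m (avoid E N)) <=
       1 / 16 * (2 * p * m (avoid E N)).
  by apply: ler_wpM2r => //; rewrite -mulrA mulr_ge0.
have : p * m (avoid E J) <= p * m (avoid E N) by apply: ler_wpM2l.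
lra.
Qed.

Theorem avoid_all_le : m (avoid E [set: I]%SET) <= (1 - p / 2) ^+ #|I| * #|T|%:R.
Proof.
rewrite -(cardsT I) -(cardsT T).
have [n] := ubnP #|[set: I]|; elim: n [set: I] => // n IHn J /ltnSE-leJn.
have [->|[i iJ]] := set_0Vmem J.
  by rewrite avoid0 cards0 expr0 mul1r.
rewrite -(setD1K iJ) cardsU1 !inE eqxx add1n exprS -mulrA.
apply: le_trans (avoid_step _) _; first by rewrite !inE eqxx.
apply: ler_wpM2l; first by move: p_small; lra.
by apply: IHn; apply: leq_trans leJn; rewrite (cardsD1 i J) iJ.
Qed.
End Sieve.

(** * Cylinders of random configurations *)

Section Cylinder.
Variables (T : finType) (q : nat).
Local Notation config := {ffun T -> 'I_q}.

Definition cyl (C : {set T}) (f : config) : {set config} :=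
  [set a : config | [forall x in C, a x == f x]].

Definition independent_of (C : {set T}) (B : {set config}) :=
  forall a b : config, (forall x, x \notin C -> a x = b x) -> (a \in B) = (b \in B).

Lemma in_cyl (C : {set T}) (f a : config) :
  reflect (forall x, x \in C -> a x = f x) (a \in cyl C f).
Proof. by rewrite inE; apply: (iffP forall_inP) => h x /h => [/eqP|->]. Qed.

(** Swapping in each cell of C the symbols prescribed by f and by g exchanges the
    two cylinders and preserves B. *)
Lemma card_cylI_le (C : {set T}) (f g : config) (B : {set config}) : independent_of C B ->
  (#|cyl C f :&: B| <= #|cyl C g :&: B|)%N.
Proof.
move=> indB.
pose s (a : config) : config := [ffun x => if x \in C then tperm (f x) (g x) (a x) else a x].
have sK : involutive s.
  by move=> a; apply/ffunP => x; rewrite !ffunE; case: ifP => xC; rewrite ?xC ?tpermK.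
rewrite -(card_imset _ (inv_inj sK)); apply: subset_leq_card.
apply/fintype.subsetP => b /imsetP[a /setIP[/in_cyl aC aB] ->].
apply/setIP; split.
  by apply/in_cyl => x xC; rewrite ffunE xC aC // tpermL.
by rewrite -(indB a) // => x xC; rewrite ffunE (negbTE xC).
Qed.

(** A cylinder on C and an event that does not look at C are independent: the
    cylinders on C with all possible prescriptions partition the space. *)
Lemma card_cylI (C : {set T}) (f : config) (B : {set config}) : independent_of C B ->
  (#|cyl C f :&: B| * q ^ #|C| = #|B|)%N.
Proof.
move=> indB.
pose G : pred config := [pred g | g \in family (fun x => if x \in C then predT else pred1 (f x))].
have cG : #|G| = (q ^ #|C|)%N.
  rewrite card_family -prod_nat_const foldrE big_map big_enum /= [RHS]big_mkcond.
  apply: eq_bigr => x _; case: ifP => xC; first by rewrite card_ord.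
  by rewrite card1.
pose r (a : config) : config := [ffun x => if x \in C then a x else f x].
rewrite -[RHS]sum1_card (partition_big r G) /=; last first.
  by move=> a _; apply/familyP => x; rewrite ffunE; case: ifP => _; rewrite !inE ?eqxx.
rewrite -cG mulnC -sum_nat_const; apply: eq_bigr => g gG.
rewrite sum1dep_card.
transitivity #|cyl C g :&: B|.
  by apply/eqP; rewrite eqn_leq !card_cylI_le.
apply: eq_card => a; rewrite in_setI !inE andbC; congr (_ && _).
apply/forall_inP/eqP => [h|<- x xC]; last by rewrite ffunE xC.
apply/ffunP => x; rewrite ffunE; case: ifP => xC; first by apply/eqP/h.
by move/familyP: gG => /(_ x); rewrite xC => /eqP.
Qed.

Variables (R : realFieldType) (I : finType) (C : I -> {set T}) (f : I -> config) (K : nat).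
Hypothesis cardC : forall i, #|C i| = K.
Hypothesis q_gt0 : (0 < q)%N.
Local Notation E i := (cyl (C i) (f i)).

Let adj i j := ~~ [disjoint C i & C j].

Lemma avoid_independent (D : {set T}) (J : {set I}) :
  (forall j, j \in J -> [disjoint D & C j]) -> independent_of D (avoid (fun i => E i) J).
Proof.
move=> dis; suff h (a b : config) : (forall x, x \notin D -> a x = b x) ->
    a \in avoid (fun i => E i) J -> b \in avoid (fun i => E i) J.
  by move=> a b ab; apply/idP/idP; apply: h => // x /ab.
move=> ab /in_avoid aJ; apply/in_avoid => j jJ.
apply: contra (aJ j jJ) => /in_cyl bC; apply/in_cyl => x xC.
by rewrite ab ?bC //; apply: contraL xC => xD; rewrite (disjointFr (dis j jJ)).
Qed.

Local Notation Q := (q%:R : R).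

(** Two cylinders that are compatible intersect in a cylinder on the union of their
    supports, whence the conditional probability q^(|C i meet C j| - K); if they
    conflict, the intersection is empty and the bound is only better. *)
Theorem cylinder_sieve :
  Q ^- K <= 1 / 16 ->
  (forall i, \sum_(j | ~~ [disjoint C i & C j] && (j != i))
       Q ^+ #|C i :&: C j| / Q ^+ K <= 1 / 16) ->
  #|avoid (fun i => E i) [set: I]|%:R <= (1 - Q ^- K / 2) ^+ #|I| * (q ^ #|T|)%:R :> R.
Proof.
move=> p_small w_sum.
have Q0 : 0 < Q by rewrite ltr0n.
have QK m : 0 < Q ^+ m by rewrite exprn_gt0.
have -> : (q ^ #|T|)%N = #|{: config}| by rewrite card_ffun card_ord.
apply: (@avoid_all_le _ _ _ (fun i => E i) adj _ (fun i j => Q ^+ #|C i :&: C j| / Q ^+ K)) => //.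
- move=> i; rewrite /adj -setI_eq0 setIid -cards_eq0 cardC.
  by apply: contraTneq p_small => ->; rewrite expr0 invr1 -ltNge; lra.
- move=> i j; rewrite ler_peMl ?invr_ge0 ?(ltW (QK _)) // exprn_ege1 // ler1n //.
- move=> i J far; have := @card_cylI (C i) (f i) (avoid (fun i => E i) J).
  rewrite cardC => <-; last first.
    by apply: avoid_independent => j /far; rewrite negbK.
  by rewrite natrM natrX mulrCA mulVf ?mulr1 // gt_eqF.
- move=> i j J far.
  have [->|[a /setIP[/in_cyl ai /in_cyl aj]]] := set_0Vmem (E i :&: E j).
    by rewrite set0I cards0 !(divr_ge0, mulr_ge0) // ?invr_ge0 ltW.
  have -> : E i :&: E j = cyl (C i :|: C j) a.
    apply/setP => b; apply/setIP/in_cyl => [[/in_cyl bi /in_cyl bj] x /setUP[xi|xj]|h].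
    + by rewrite bi ?ai.
    + by rewrite bj ?aj.
    + split; apply/in_cyl => x xC.
        by rewrite h ?ai // in_setU xC.
      by rewrite h ?aj // in_setU xC orbT.
  have := @card_cylI (C i :|: C j) a (avoid (fun i => E i) J).
  move=> <-; last first.
    apply: avoid_independent => l /far; rewrite !negbK => /andP[d1 d2].
    by rewrite -setI_eq0 setIUl setU_eq0 !setI_eq0 d1.
  have := cardsUI (C i) (C j); rewrite !cardC => cU.
  have : Q ^+ #|C i :|: C j| * Q ^+ #|C i :&: C j| = Q ^+ K * Q ^+ K by rewrite -!exprD cU.
  rewrite natrM natrX => e.
  have e2 : Q ^- K * (Q ^+ #|C i :&: C j| / Q ^+ K) * Q ^+ #|C i :|: C j| = 1.
    rewrite -mulrA [X in _ * X]mulrAC [X in _ * (X / _)]mulrC e.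
    by rewrite mulfK ?gt_eqF // mulVf // gt_eqF.
  by rewrite mulrCA e2 mulr1.
Qed.
End Cylinder.

(** * Containment by increasing embeddings *)

Section Increasing.
Variables (m n : nat) (phi : 'I_m -> 'I_n).
Hypothesis incr : forall x y : 'I_m, (x < y)%N -> (phi x < phi y)%N.

Lemma incr_lower (x : 'I_m) : (x <= phi x)%N.
Proof.
case: x; elim=> // x IH lt_xm.
by apply: leq_ltn_trans (IH (ltnW lt_xm)) (incr _).
Qed.

(** The m - x values of phi from x on are distinct and at least phi x. *)
Lemma incr_upper (x : 'I_m) : (phi x + (m - x) <= n)%N.
Proof.
have [k] := ubnP (m - x); elim: k x => // k IH x le_k.
have [e|ne] := eqVneq x.+1 m.
  by rewrite -[X in (X - x)%N]e subSnn addn1.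
have lt_xm : (x.+1 < m)%N by rewrite ltn_neqAle ne ltn_ord.
have := incr (ltnSn x : x < Ordinal lt_xm)%N.
have := IH (Ordinal lt_xm); rewrite /=; lia.
Qed.

Lemma incr_inj : injective phi.
Proof.
move=> x y e; apply: val_inj; case: (ltngtP x y) => // /incr; rewrite e ltnn //.
Qed.
End Increasing.

Lemma incr_endo n (phi : 'I_n -> 'I_n) :
  (forall x y : 'I_n, (x < y)%N -> (phi x < phi y)%N) -> forall x, phi x = x.
Proof.
move=> incr x; apply: val_inj => /=.
have := incr_lower incr x; have := incr_upper incr x; have := ltn_ord x; lia.
Qed.

(** As long as some direction j has a coordinate l outside the image of [phi j],
    delete it: [phi] then factors through the restricted array, by the inverse
    [unbump l] of the renumbering. Once no coordinate is left to delete, an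
    increasing map between equal ranges is the identity. *)
Lemma contains_embed d q (n m : 'I_d -> nat) (A : darray q n) (B : darray q m)
    (phi : forall j, 'I_(m j) -> 'I_(n j)) :
  (forall j (x y : 'I_(m j)), (x < y)%N -> (phi j x < phi j y)%N) ->
  (forall x : array_index m, B x = A [ffun j => phi j (x j)]) ->
  contains A B.
Proof.
have [s] := ubnP (\sum_j (n j - m j))%N.
elim: s => // s IH in n A phi * => /ltnSE-le_s incr agree.
have [/existsP[j lt_mn]|/existsPn ge_mn] := boolP [exists j, (m j < n j)%N]; last first.
  have e : m = n.
    apply/funext => j; apply/eqP; rewrite eqn_leq [X in _ && X]leqNgt ge_mn andbT.
    by have := leq_card _ (@incr_inj _ _ _ (incr j)); rewrite !card_ord.
  subst m; have -> : B = A; last exact: contains_refl.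
  apply/ffunP => x; rewrite agree; congr (A _); apply/ffunP => j.
  by rewrite ffunE incr_endo //; exact: incr.
have [l l_im] : exists l, l \notin codom (phi j).
  apply/existsP; rewrite -negb_forall; apply: contraL lt_mn => /forallP im.
  rewrite -leqNgt -{1}(card_ord (n j)) -(card_ord (m j)) -(card_codom (@incr_inj _ _ _ (incr j))).
  by apply: subset_leq_card; apply/fintype.subsetP => y _; apply: im.
have ne x : l != phi j x by apply: contraNneq l_im => ->; exact: codom_f.
have bound i (x : 'I_(m i)) :
    ((if i == j then unbump l (phi i x) else phi i x) < del_size n j i)%N.
  rewrite /del_size; case: eqP => [e|//]; subst i.
  have := ltn_ord (phi j x); have := ltn_ord l; have := ne x.
  rewrite -val_eqE /= /unbump; case: ltngtP; lia.
pose phi' i x := Ordinal (bound i x).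
have undelK i x : undel_coord l (phi' i x) = phi i x.
  apply: val_inj; rewrite /= undel_coordE /=; case: eqP => // e; subst i.
  by rewrite unbumpK // inE eq_sym; apply: ne.
apply: (contains_restrict (l := l)); apply: (IH _ _ phi').
- apply: leq_trans le_s.
  rewrite (bigD1 j) //= [X in (_ < X)%N](bigD1 j) //= /del_size eqxx.
  rewrite -addSn leq_add //; first by lia.
  by apply: leq_sum => i /negbTE ->.
- move=> i x y xy /=; have := incr i _ _ xy; case: eqP => // e; subst i.
  by have := ne x; have := ne y; rewrite -!val_eqE /= /unbump; do 2! case: ltngtP; lia.
- move=> x; rewrite agree ffunE; congr (A _); apply/ffunP => i.
  by rewrite !ffunE undelK.
Qed.

(** * Boxes carrying a given pattern *)

Lemma clip_subproof m (m_gt0 : (0 < m)%N) (x : nat) : (minn x m.-1 < m)%N.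
Proof. by rewrite gtn_min prednK // leqnn orbT. Qed.

(** Truncation to a nonempty range, so that arbitrary numbers can be used as
    coordinates without side conditions. *)
Definition clip m (m_gt0 : (0 < m)%N) (x : nat) : 'I_m :=
  Ordinal (clip_subproof m_gt0 x).

Lemma clipK m (m_gt0 : (0 < m)%N) (x : 'I_m) : clip m_gt0 x = x.
Proof. by apply: val_inj; rewrite /=; have := ltn_ord x; lia. Qed.

Section Slot.
Variables (n k : nat) (S : {set 'I_n}) (cardS : #|S| = k).

(** The increasing bijection from 'I_k onto S, as [enum] lists S in order. *)
Definition slot (x : 'I_k) : 'I_n := enum_val (cast_ord (esym cardS) x).

Lemma slot_in x : slot x \in S.
Proof. exact: enum_valP. Qed.

Lemma index_slot x : index (slot x) (enum S) = x.
Proof.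
rewrite /slot /enum_val index_uniq ?enum_uniq //.
by rewrite -cardE ltn_ord.
Qed.

Lemma slot_incr (x y : 'I_k) : (x < y)%N -> (slot x < slot y)%N.
Proof.
move=> xy.
have srt : sorted (fun a b : 'I_n => (a < b)%N) (enum S).
  rewrite /enum_mem; apply: sorted_filter; first by move=> ? ? ?; apply: ltn_trans.
  have : sorted ltn (map val (enum 'I_n)) by rewrite val_enum_ord iota_ltn_sorted.
  by rewrite sorted_map -enumT.
have e x0 z : slot z = nth x0 (enum S) z.
  by rewrite /slot /enum_val; apply: set_nth_default; rewrite -cardE ltn_ord.
have [x0 _] : exists x0 : 'I_n, True by exists (slot x).
rewrite (e x0 x) (e x0 y).
by apply: (sorted_ltn_nth _ _ srt) => //; rewrite ?inE -?cardE ?cardS // => ? ? ?; apply: ltn_trans.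
Qed.
End Slot.

Section Boxes.
Variables (d q n k : nat) (W : {set 'I_n}).
Hypotheses (q_gt0 : (0 < q)%N) (k_gt0 : (0 < k)%N).

Definition side := {S : {set 'I_n} | (S \subset W) && (#|S| == k)}.

Lemma card_side_set (S : side) : #|val S| = k.
Proof. by case/andP: (valP S) => _ /eqP. Qed.

Local Notation order_n := (fun _ : 'I_d => n).
Local Notation order_k := (fun _ : 'I_d => k).
Local Notation cell := (array_index order_n).

Definition box (S : {ffun 'I_d -> side}) : {set cell} :=
  [set x : cell | [forall j, x j \in val (S j)]].

(** The configuration that B prescribes on the box S. The events only compare it
    with the array on the box; truncation makes it total. *)
Definition copy (B : darray q order_k) (S : {ffun 'I_d -> side}) : darray q order_n :=
  [ffun x : cell => B [ffun j => clip k_gt0 (index (x j) (enum (val (S j))))]].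

Lemma card_boxes : #|{ffun 'I_d -> side}| = ('C(#|W|, k) ^ d)%N.
Proof.
rewrite card_ffun card_ord card_sig -cards_draws; congr (_ ^ _)%N.
by apply: eq_card => S; rewrite !inE.
Qed.

Lemma card_cells : #|{: cell}| = (n ^ d)%N.
Proof.
by rewrite card_dep_ffun foldrE big_map big_enum /= prod_nat_const !card_ord.
Qed.

Lemma card_boxI (S T : {ffun 'I_d -> side}) :
  #|box S :&: box T| = (\prod_j #|val (S j) :&: val (T j)|)%N.
Proof.
pose F (j : 'I_d) : pred 'I_n := [pred x | x \in val (S j) :&: val (T j)].
transitivity #|(family F : simpl_pred cell)|.
  apply: eq_card => x; rewrite in_setI !inE -[RHS]/([forall j, x j \in F j]).
  apply/andP/forallP => [[/forallP xS /forallP xT] j|h].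
    by rewrite !inE xS xT.
  by split; apply/forallP => j; have := h j; rewrite !inE => /andP[].
rewrite card_family foldrE big_map big_enum /=; apply: eq_bigr => j _.
by apply: eq_card => x; rewrite !inE.
Qed.

Lemma card_box (S : {ffun 'I_d -> side}) : #|box S| = (k ^ d)%N.
Proof.
rewrite -[box S]setIid card_boxI; under eq_bigr do rewrite setIid card_side_set.
by rewrite prod_nat_const card_ord.
Qed.

(** A pattern of smaller size is a corner of a pattern of order k, obtained by
    filling the missing cells arbitrarily, here by truncating coordinates. *)
Lemma universal_of_copies (A : darray q order_n) :
  (forall B : darray q order_k, exists S, A \in cyl (box S) (copy B S)) ->
  universal k A.
Proof.
move=> copies m bound_m B.
have m_gt0 j : (0 < m j)%N by case/andP: (bound_m j).
have m_le j : (m j <= k)%N by case/andP: (bound_m j).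
pose B' : darray q order_k := [ffun x : array_index order_k => B [ffun j => clip (m_gt0 j) (x j)]].
have [S /in_cyl AS] := copies B'.
apply: (@contains_embed _ _ _ _ _ _
  (fun j x => slot (card_side_set (S j)) (widen_ord (m_le j) x))) => [j x y xy|x].
  exact: slot_incr.
rewrite AS; last by rewrite inE; apply/forallP => j; rewrite ffunE slot_in.
rewrite !ffunE; congr (B _); apply/ffunP => j; rewrite !ffunE index_slot /=.
apply: val_inj; rewrite /=; have := m_le j; have := ltn_ord (x j); lia.
Qed.

Variable R : realFieldType.
Local Notation Q := (q%:R : R).

(** The union bound over the q^(k^d) patterns of order k. Two boxes share a cell if
    and only if their sides meet in every direction. *)
Theorem few_nonuniversal :
  Q ^- (k ^ d) <= 1 / 16 ->
  (forall S : {ffun 'I_d -> side},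
     \sum_(T : {ffun 'I_d -> side} |
         [forall j, 0 < #|val (S j) :&: val (T j)|]%N && (T != S))
       Q ^+ (\prod_j #|val (S j) :&: val (T j)|)%N / Q ^+ (k ^ d) <= 1 / 16) ->
  #|[pred A : darray q order_n | ~~ `[< universal k A >]]|%:R <=
    Q ^+ (k ^ d) * (1 - Q ^- (k ^ d) / 2) ^+ ('C(#|W|, k) ^ d) * Q ^+ (n ^ d).
Proof.
move=> p_small w_sum; rewrite -[X in X%:R <= _]cardsE.
pose bad (B : darray q order_k) := avoid (fun S => cyl (box S) (copy B S)) [set: _].
have sub : [set A in [pred A : darray q order_n | ~~ `[< universal k A >]]]
    \subset \bigcup_B bad B.
  apply/fintype.subsetP => A; rewrite !inE => nU; apply/bigcupP.
  have [/existsP[B AB]|/existsPn h] := boolP [exists B, A \in bad B]; first by exists B.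
  case/negP: nU; apply/asboolP/universal_of_copies => B; have := h B.
  rewrite inE negb_forall_in => /exists_inP[S _]; rewrite negbK => AS.
  by exists S.
apply: (@le_trans _ _ (\sum_B #|bad B|%:R)).
  rewrite -natr_sum ler_nat; apply: leq_trans (subset_leq_card sub) _.
  elim/big_rec2: _ => [|j y z _ le]; first by rewrite cards0.
  by apply: leq_trans (leq_card_setU _ _) _; rewrite leq_add2l.
rewrite [X in _ <= X * _ * _](_ : _ = \sum_(B : darray q order_k) 1); last first.
  rewrite sumr_const card_ffun card_ord card_dep_ffun foldrE big_map big_enum /=.
  by rewrite prod_nat_const !card_ord natrX.
rewrite -mulrA mulr_suml; apply: ler_sum => B _; rewrite mul1r.
have := @cylinder_sieve _ q R _ box (copy B) (k ^ d)%N card_box q_gt0 p_small.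
rewrite card_boxes card_cells natrX; apply=> S.
apply: le_trans (w_sum S).
rewrite [leLHS]big_mkcond [leRHS]big_mkcond; apply: ler_sum => T _.
have [e|ne] := eqVneq T S; first by rewrite !andbF.
have -> : ~~ [disjoint box S & box T] = [forall j, 0 < #|val (S j) :&: val (T j)|]%N.
  rewrite -setI_eq0 -card_gt0 card_boxI; apply/idP/forallP => [h j|h].
    by move: h; rewrite (bigD1 j) //= muln_gt0 => /andP[].
  by rewrite prodn_gt0.
by rewrite card_boxI.
Qed.
End Boxes.

(** * The expected number of overlapping boxes *)

Section SideSum.
Variables (R : realFieldType) (n k : nat) (W : {set 'I_n}).

(** U is determined by its traces inside and outside S. *)
Lemma card_sides_meeting (S : {set 'I_n}) (l : nat) : #|S| = k -> (l <= k)%N ->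
  (#|[set U : {set 'I_n} | (U \subset W) && (#|U| == k) && (#|S :&: U| == l)]| <=
   'C(k, l) * 'C(#|W|, k - l))%N.
Proof.
move=> cS le_lk.
have -> : 'C(k, l) = 'C(#|S|, l) by rewrite cS.
rewrite -(cards_draws S l) -(cards_draws W (k - l)%N) -cardsX.
pose split (U : {set 'I_n}) := (S :&: U, U :\: S).
have split_inj : injective split.
  by move=> U V [e1 e2]; rewrite -(setID U S) -(setID V S) e2 ![_ :&: S]setIC e1.
rewrite -(card_imset _ split_inj); apply: subset_leq_card.
apply/fintype.subsetP => _ /imsetP[U + ->]; rewrite !inE => /andP[/andP[UW /eqP cU] /eqP cI].
rewrite subsetIl cI eqxx /= (fintype.subset_trans (subsetDl _ _) UW) /=.
by rewrite cardsD cU setIC cI.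
Qed.

Lemma side_sum (S : side k W) (f : nat -> R) : (forall l, 0 <= f l) ->
  \sum_(U : side k W) f #|val S :&: val U| <=
  \sum_(l < k.+1) ('C(k, l) * 'C(#|W|, k - l))%:R * f l.
Proof.
move=> f0; pose P := [pred U : {set 'I_n} | (U \subset W) && (#|U| == k)].
rewrite -(big_sub P (fun U => f #|val S :&: U|)) /=.
pose r (U : {set 'I_n}) : 'I_k.+1 := inord #|val S :&: U|.
have rE U : #|val S :&: U| = r U.
  rewrite inordK // ltnS; apply: leq_trans (subset_leq_card (subsetIl _ _)) _.
  by rewrite card_side_set.
rewrite (partition_big r xpredT) //=; apply: ler_sum => l _.
rewrite (eq_bigr (fun=> f l)); last by move=> U /andP[_ /eqP <-]; rewrite rE.
rewrite sumr_const -[leLHS]mulr_natl; apply: ler_wpM2r => //; rewrite ler_nat.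
apply: leq_trans (card_sides_meeting (card_side_set S) (ltn_ord l : (l <= k)%N)).
rewrite -[X in (_ <= X)%N]cardsE; apply/subset_leq_card/fintype.subsetP => U.
by rewrite !inE => /andP[/andP[-> ->] /eqP <-]; rewrite rE /= eqxx.
Qed.
End SideSum.

(** The relation between th and q says that th^-2 is Q = q^(k^(d-1)/d), the growth
    rate of the order of the array per coordinate. With M = d k and L the sum of
    the l_j, the inequality of the means bounds the exponent of q in such a way
    that the left-hand side is at most th^(2 (M^2 - L^2) / M); the first term on
    the right covers L <= M/2 and the second one L >= M/2. Both terms are
    products over the directions. *)
Lemma overlap_weight (R : realType) (d q k : nat) (th : R) (l : 'I_d -> nat) :
  (2 <= d)%N -> (0 < q)%N -> (0 < k)%N -> 0 < th -> th <= 1 ->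
  th ^+ (2 * d) * q%:R ^+ (k ^ d.-1) = 1 -> (forall j, (l j <= k)%N) ->
  q%:R ^+ (\prod_j l j)%N / q%:R ^+ (k ^ d) <=
    th ^+ (\sum_j (2 * (k - l j) + l j)) + th ^+ (\sum_j 3 * (k - l j)).
Proof.
move=> d2 q0 k0 th0 th1 thq lk.
pose L := (\sum_j l j)%N.
have sumB : (\sum_j (k - l j) + L = d * k)%N.
  rewrite -big_split /= (eq_bigr (fun=> k)) => [|j _]; last by rewrite subnK.
  by rewrite sum_nat_const card_ord.
have LE : (L <= d * k)%N by lia.
rewrite big_split /= -!big_distrr /=.
have -> : (\sum_j (k - l j) = d * k - L)%N by lia.
rewrite -/L.
have agm : (\prod_j l j)%:R <= (L%:R / d%:R) ^+ d :> R.
  have := @leif_AGM R 'I_d predT (fun j => (l j)%:R) (fun j _ => ler0n _ _).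
  case=> + _; rewrite card_ord -natr_sum -natr_prod; congr (_ <= _).
have d0 : 0 < d%:R :> R by rewrite ltr0n; lia.
have k0' : 0 < k%:R :> R by rewrite ltr0n.
have LE' : L%:R <= d%:R * k%:R :> R by rewrite -natrM ler_nat.
have prod_le : (\prod_j l j)%:R <= (L%:R / d%:R) ^+ 2 * k%:R ^+ d.-2 :> R.
  apply: le_trans agm _; rewrite -{2}(subnK d2) addnC exprD subn2.
  apply: ler_wpM2l; first by rewrite exprn_ge0 // divr_ge0.
  by rewrite lerXn2r ?nnegrE ?divr_ge0 // ler_pdivrMr // mulrC.
pose s := - ln th; have thE : th = expR (- s) by rewrite opprK lnK.
have s0 : 0 <= s by rewrite oppr_ge0 ln_le0.
pose lq := ln (q%:R : R); have qE : q%:R = expR lq by rewrite lnK // posrE ltr0n.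
have rel : lq * k%:R ^+ d.-1 = 2 * d%:R * s.
  move: thq; rewrite thE qE -!expRM_natl -expRD => /(congr1 (@ln R)).
  rewrite expRK ln1 natrM natrX; lra.
rewrite thE qE -!expRM_natl -expRN -expRD natrX.
have lq0 : 0 <= lq by rewrite ln_ge0 // ler1n.
have k1 : k%:R ^+ d.-1 = k%:R ^+ d.-2 * k%:R :> R by rewrite -exprSr prednK // -ltnS prednK // ltnW.
have prod_le2 : lq * (\prod_j l j)%:R * (d%:R * k%:R) <= 2 * s * L%:R ^+ 2.
  have -> : 2 * s * L%:R ^+ 2 = lq * ((L%:R / d%:R) ^+ 2 * k%:R ^+ d.-2) * (d%:R * k%:R).
    have -> : 2 * s = lq * k%:R ^+ d.-1 / d%:R by rewrite rel; field; rewrite gt_eqF.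
    by rewrite k1; field; rewrite gt_eqF.
  by apply: ler_wpM2r; [rewrite mulr_ge0 // ltW | apply: ler_wpM2l].
have kd : lq * k%:R ^+ d = 2 * d%:R * s * k%:R.
  by rewrite -rel -mulrA -exprSr prednK // ltnW.
have M0 : 0 < d%:R * k%:R :> R by apply: mulr_gt0.
have L0 : 0 <= L%:R :> R by [].
rewrite natrD !natrM natrB // natrM.
set P := _%:R in prod_le2 *; set M := d%:R * k%:R in prod_le2 M0 LE' *.
have kd' : lq * k%:R ^+ d = 2 * s * M by rewrite kd /M; ring.
have key x : x * M <= 2 * (M ^+ 2 - L%:R ^+ 2) ->
    expR (P * lq - k%:R ^+ d * lq) <= expR (x * - s).
  move=> h; rewrite ler_expR -(ler_pM2r M0).
  have -> : (P * lq - k%:R ^+ d * lq) * M = lq * P * M - 2 * s * M ^+ 2.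
    by rewrite (mulrC _ lq) (mulrC _ lq) kd'; ring.
  have := ler_wpM2l s0 h; lra.
have [LM|ML] := lerP (2 * L%:R) M.
  apply: (@le_trans _ _ (expR ((2 * (M - L%:R) + L%:R) * - s))).
    by apply: key; have := ler_wpM2r L0 LM; lra.
  by rewrite lerDl expR_ge0.
apply: (@le_trans _ _ (expR (3 * (M - L%:R) * - s))); last by rewrite lerDr expR_ge0.
apply: key; have : 0 <= (M - L%:R) * (2 * L%:R - M) by rewrite mulr_ge0 // subr_ge0 // ltW.
lra.
Qed.

Section Overlap.
Variables (R : realType) (d q n k : nat) (W : {set 'I_n}) (th tau : R).
Hypotheses (d2 : (2 <= d)%N) (q_gt0 : (0 < q)%N) (k_gt0 : (0 < k)%N).
Hypotheses (th_gt0 : 0 < th) (th_le1 : th <= 1)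
  (th_q : th ^+ (2 * d) * q%:R ^+ (k ^ d.-1) = 1).
Hypotheses (tau_ge0 : 0 <= tau) (tau_small : tau <= (32 * 2 ^+ d)^-1).
Hypothesis small_overlap : forall l, (0 < l <= k)%N ->
  ('C(k, l) * 'C(#|W|, k - l))%:R * th ^+ (2 * (k - l) + l) <= tau / k%:R.
Hypothesis large_overlap : forall l, (l < k)%N ->
  ('C(k, l) * 'C(#|W|, k - l))%:R * th ^+ (3 * (k - l)) <= tau / k%:R.

(** The weights per direction. A box T that meets S has no empty trace, so the
    value of g1 at 0 may be set to 0; the box S itself has weight 1 for g2, and is
    to be subtracted. *)
Let g1 l : R := if l == 0%N then 0 else th ^+ (2 * (k - l) + l).
Let g2 l : R := th ^+ (3 * (k - l)).

Lemma sum_g1 (S : side k W) : \sum_(U : side k W) g1 #|val S :&: val U| <= tau.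
Proof.
apply: le_trans (side_sum _ _) _.
  by move=> l; rewrite /g1; case: eqP => // _; rewrite exprn_ge0 // ltW.
rewrite big_ord_recl /g1 /= mulr0 add0r.
apply: (@le_trans _ _ (\sum_(i < k) tau / k%:R)).
  by apply: ler_sum => i _; apply: small_overlap; rewrite /= /bump /= add1n ltn_ord.
by rewrite sumr_const card_ord -[leLHS]mulr_natr mulfVK // pnatr_eq0 -lt0n.
Qed.

Lemma sum_g2 (S : side k W) : \sum_(U : side k W) g2 #|val S :&: val U| <= 1 + tau.
Proof.
apply: le_trans (side_sum _ _) _.
  by move=> l; rewrite exprn_ge0 // ltW.
rewrite big_ord_recr /g2 /= subnn binn bin0 muln0 expr0 !mulr1 addrC lerD2l.
apply: (@le_trans _ _ (\sum_(i < k) tau / k%:R)).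
  by apply: ler_sum => i _; apply: large_overlap; rewrite /= ltn_ord.
by rewrite sumr_const card_ord -[leLHS]mulr_natr mulfVK // pnatr_eq0 -lt0n.
Qed.

Lemma tau_le1 : tau <= 1.
Proof.
apply: le_trans tau_small _; rewrite invf_le1 ?mulr_gt0 ?exprn_gt0 //.
have : 1 <= 2 ^+ d :> R by rewrite exprn_ege1 // ler1n.
lra.
Qed.

Lemma exp1D_le (m : nat) : (1 + tau) ^+ m <= 1 + (2 ^+ m - 1) * tau.
Proof.
elim: m => [|m IH]; first by rewrite !expr0; lra.
rewrite !exprS.
have m1 : 0 <= 2 ^+ m - 1 :> R by rewrite subr_ge0 exprn_ege1 // ler1n.
have : (1 + tau) * (1 + tau) ^+ m <= (1 + tau) * (1 + (2 ^+ m - 1) * tau).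
  by apply: ler_wpM2l => //; move: tau_ge0; lra.
have : tau * ((2 ^+ m - 1) * tau) <= 1 * ((2 ^+ m - 1) * tau).
  by apply: ler_wpM2r; [apply: mulr_ge0 | exact: tau_le1].
lra.
Qed.

(** The sums of products over boxes are products over the d directions of sums over
    sides: the total is at most tau^d + (1 + tau)^d - 1. *)
Theorem overlap_sum (S : {ffun 'I_d -> side k W}) :
  \sum_(T : {ffun 'I_d -> side k W} |
         [forall j, 0 < #|val (S j) :&: val (T j)|]%N && (T != S))
       q%:R ^+ (\prod_j #|val (S j) :&: val (T j)|)%N / q%:R ^+ (k ^ d) <= 1 / 16 :> R.
Proof.
pose o (T : {ffun 'I_d -> side k W}) j := #|val (S j) :&: val (T j)|.
have o_le T j : (o T j <= k)%N.
  by rewrite -[X in (_ <= X)%N](card_side_set (S j)) subset_leq_card // subsetIl.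
have g1_ge0 l : 0 <= g1 l by rewrite /g1; case: eqP => // _; rewrite exprn_ge0 // ltW.
have g2_ge0 l : 0 <= g2 l by rewrite exprn_ge0 // ltW.
apply: (@le_trans _ _ (\sum_(T : {ffun 'I_d -> side k W}) \prod_j g1 (o T j) +
   \sum_(T : {ffun 'I_d -> side k W} | T != S) \prod_j g2 (o T j))).
  rewrite [leLHS]big_mkcond [X in _ <= _ + X]big_mkcond -big_split /=.
  apply: ler_sum => T _; case: ifP; last first.
    by move=> _; case: ifP => _; rewrite addr_ge0 ?prodr_ge0.
  case/andP => /forallP meet ->.
  apply: le_trans (overlap_weight d2 q_gt0 k_gt0 th_gt0 th_le1 th_q (o_le T)) _.
  rewrite !expr_sum; apply: lerD => //; rewrite le_eqVlt; apply/orP; left; apply/eqP/eq_bigr => j _.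
  by rewrite /g1 eqn0Ngt meet.
have S_g2 : \prod_j g2 (o S j) = 1.
  by apply: big1 => j _; rewrite /g2 /o setIid card_side_set subnn muln0 expr0.
have -> : \sum_(T : {ffun 'I_d -> side k W} | T != S) \prod_j g2 (o T j) =
    \sum_(T : {ffun 'I_d -> side k W}) \prod_j g2 (o T j) - 1.
  by rewrite [in RHS](bigD1 S) //= S_g2 addrC addrK.
rewrite -(bigA_distr_bigA (fun j (U : side k W) => g1 #|val (S j) :&: val U|)).
rewrite -(bigA_distr_bigA (fun j (U : side k W) => g2 #|val (S j) :&: val U|)).
have le1 : \prod_j \sum_U g1 #|val (S j) :&: val (U : side k W)| <= tau ^+ d.
  rewrite -[X in _ ^+ X]card_ord -prodr_const; apply: ler_prod => j _.
  by rewrite sumr_ge0 //= sum_g1.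
have le2 : \prod_j \sum_U g2 #|val (S j) :&: val (U : side k W)| <= (1 + tau) ^+ d.
  rewrite -[X in _ ^+ X]card_ord -prodr_const; apply: ler_prod => j _.
  by rewrite sumr_ge0 //= sum_g2.
have le3 : tau ^+ d <= tau.
  by rewrite -[leRHS]expr1 ler_wiXn2l ?tau_le1 //; lia.
have le4 : 2 ^+ d * tau <= 1 / 32.
  have h : 0 < 32 * 2 ^+ d :> R by rewrite mulr_gt0 ?exprn_gt0.
  by have := tau_small; rewrite -(ler_pM2l h) mulfV ?gt_eqF //; lra.
have := exp1D_le d; lra.
Qed.
End Overlap.

(** * Binomial estimates *)

Lemma bin_fact_le n m : ('C(n, m) * m`! <= n ^ m)%N.
Proof.
rewrite bin_ffact; elim: m => // m IH.
by rewrite ffactnSr expnSr leq_mul // leq_subr.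
Qed.

Lemma bin_le_expn n m : ('C(n, m) <= n ^ m)%N.
Proof.
by apply: leq_trans (bin_fact_le n m); rewrite leq_pmulr // fact_gt0.
Qed.

Lemma bin_fact_ge n m : ((n - m) ^ m <= 'C(n, m) * m`!)%N.
Proof.
rewrite bin_ffact.
suff h j : (j <= m)%N -> ((n - m) ^ j <= n ^_ j)%N by apply: h.
elim: j => // j IH ltjm; rewrite ffactnSr expnSr.
by apply: leq_mul; [exact/IH/ltnW | exact/leq_sub2l/ltnW].
Qed.

Section Factorials.
Variable R : realType.
Local Notation e := (expR 1 : R).

(** A single term of the exponential series at k. *)
Lemma pow_fact_le_exp (k m : nat) : k%:R ^+ m <= e ^+ k * m`!%:R.
Proof.
rewrite -expRM_natl mulr1 -ler_pdivrMr ?ltr0n ?fact_gt0 //.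
case: m => [|m]; last first.
  apply: le_trans (expR_ge1Dxn m (ler0n R k)).
  by rewrite lerDr.
rewrite expr0 fact0 divr1; have := expR_ge1Dx (k%:R : R).
by have := ler0n R k; lra.
Qed.

(** The quotient of two consecutive instances is the inequality
    e <= (1 + 1/k)^(k+1). *)
Lemma fact_le_pow (k : nat) : (0 < k)%N -> k`!%:R * e ^+ k <= e * k%:R ^+ k.+1.
Proof.
elim: k => // -[|k] IH _; first by rewrite factS fact0 !expr1 expr1n mul1r mulr1.
set K := k.+1 in IH *; have K0 : 0 < K%:R :> R by rewrite ltr0n.
have K1 : 0 < K.+1%:R :> R by rewrite ltr0n.
have step : K%:R ^+ K.+1 * e <= K.+1%:R ^+ K.+1.
  have : (1 - K.+1%:R^-1) ^+ K.+1 <= e^-1 :> R.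
    rewrite -expRN.
    have -> : -1 = K.+1%:R * - K.+1%:R^-1 :> R by rewrite mulrN mulfV ?gt_eqF.
    rewrite expRM_natl lerXn2r ?nnegrE ?expR_ge0 ?expR_ge1Dx //.
    by rewrite subr_ge0 invf_le1 // ler1n.
  have -> : 1 - K.+1%:R^-1 = K%:R / K.+1%:R :> R.
    by rewrite -[K.+1%:R]natr1; field; rewrite natr1 gt_eqF.
  rewrite expr_div_n ler_pdivrMr ?exprn_gt0 // mulrC ler_pdivlMr ?expR_gt0 //.
rewrite factS natrM exprS.
have -> : K.+1%:R * K`!%:R * (e * e ^+ K) = K.+1%:R * e * (K`!%:R * e ^+ K) by ring.
apply: le_trans (ler_wpM2l _ (IH isT)) _; first by rewrite mulr_ge0 // ltW // expR_gt0.
have -> : K.+1%:R * e * (e * K%:R ^+ K.+1) = e * K.+1%:R * (K%:R ^+ K.+1 * e) by ring.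
rewrite [K.+1%:R ^+ K.+2]exprS [leRHS]mulrA.
by apply: ler_wpM2l => //; rewrite mulr_ge0 // expR_ge0.
Qed.
End Factorials.

Section Numerics.
Variables (R : realType) (k w : nat) (c c' th : R).
Local Notation e := (expR 1 : R).
Hypotheses (k_gt0 : (0 < k)%N) (c_ge1 : 1 <= c) (th_gt0 : 0 < th).
Hypothesis w_le : w%:R <= c * (k%:R / e) * th ^- 2.
Hypothesis small : c ^+ k * e * k%:R ^+ 2 * th <= 1.

Let k1 : 1 <= k%:R :> R. Proof. by rewrite ler1n. Qed.
Let e1 : 1 <= e. Proof. by have := expR_ge1Dx (1 : R); lra. Qed.
Let c0 : 0 <= c. Proof. by move: c_ge1; lra. Qed.
Let k0 : 0 <= k%:R :> R. Proof. exact: ler0n. Qed.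
Let e0 : 0 < e. Proof. exact: expR_gt0. Qed.

Lemma bin_fact_scaled m : ('C(w, m) * m`!)%:R * th ^+ (2 * m) <= (c * k%:R / e) ^+ m.
Proof.
have : ('C(w, m) * m`!)%:R <= w%:R ^+ m :> R by rewrite -natrX ler_nat bin_fact_le.
have : w%:R ^+ m <= (c * (k%:R / e) * th ^- 2) ^+ m.
  by rewrite lerXn2r ?nnegrE // (le_trans _ w_le).
move=> h1 h2; have := le_trans h2 h1.
rewrite exprMn exprVn -exprM -ler_pdivrMr ?invr_gt0 ?exprn_gt0 // invrK.
by rewrite mulrA.
Qed.

(** For few common coordinates, the m = k - l others are chosen in about
    (c k Q / e)^m / m! ways, and (k / e)^m / m! <= e^l is a term of the series of
    e^k divided by e^m; the loss c^m is absorbed since l > 0. *)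
Lemma small_overlap_bound l : (0 < l <= k)%N ->
  ('C(k, l) * 'C(w, k - l))%:R * th ^+ (2 * (k - l) + l) <=
    c ^+ k * e * k%:R ^+ 2 * th.
Proof.
case/andP=> l0 lk; set m := (k - l)%N; pose t0 := c ^+ k * e * k%:R ^+ 2 * th.
have t00 : 0 <= t0 by rewrite !mulr_ge0 ?exprn_ge0 // ltW.
have b1 : 'C(k, l)%:R <= k%:R ^+ l :> R by rewrite -natrX ler_nat bin_le_expn.
have b2 : 'C(w, m)%:R * th ^+ (2 * m) <= c ^+ m * e ^+ l.
  have f0 : 0 < m`!%:R :> R by rewrite ltr0n fact_gt0.
  rewrite -(ler_pM2r f0) mulrAC -natrM; apply: le_trans (bin_fact_scaled m) _.
  rewrite expr_div_n exprMn ler_pdivrMr ?exprn_gt0 // -!mulrA.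
  apply: ler_wpM2l; first exact: exprn_ge0.
  apply: le_trans (pow_fact_le_exp R k m) _.
  by rewrite -{1}(subnKC lk) exprD -/m -mulrA [X in _ <= _ * X]mulrC.
have b3 : c ^+ m <= (c ^+ k) ^+ l
  by rewrite -exprM ler_weXn2l // (leq_trans (leq_subr l k)) // leq_pmulr.
apply: (@le_trans _ _ (t0 ^+ l)); last by rewrite -[leRHS]expr1 ler_wiXn2l.
rewrite natrM exprD.
have -> : 'C(k, l)%:R * 'C(w, m)%:R * (th ^+ (2 * m) * th ^+ l) =
    ('C(k, l)%:R * th ^+ l) * ('C(w, m)%:R * th ^+ (2 * m)) by ring.
have -> : t0 ^+ l = (k%:R ^+ l * th ^+ l) * ((c ^+ k) ^+ l * e ^+ l * k%:R ^+ l).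
  by rewrite /t0; move: (c ^+ k) => ck; rewrite expr2 !exprMn; ring.
apply: ler_pM.
- by rewrite mulr_ge0 // exprn_ge0 // ltW.
- by rewrite mulr_ge0 // exprn_ge0 // ltW.
- by apply: ler_wpM2r => //; rewrite exprn_ge0 // ltW.
- apply: le_trans b2 _; rewrite -[leLHS]mulr1; apply: ler_pM => //.
  + by rewrite mulr_ge0 // exprn_ge0 // ltW.
  + by apply: ler_wpM2r => //; rewrite exprn_ge0 // ltW.
  + by rewrite exprn_ege1.
Qed.

(** For many common coordinates, m = k - l is small and crude polynomial bounds in k
    for the choice of each of the m missing and m new coordinates suffice. *)
Lemma large_overlap_bound l : (l < k)%N ->
  ('C(k, l) * 'C(w, k - l))%:R * th ^+ (3 * (k - l)) <=
    c ^+ k * e * k%:R ^+ 2 * th.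
Proof.
move=> lk; rewrite -(bin_sub (ltnW lk)); set m := (k - l)%N.
pose t0 := c ^+ k * e * k%:R ^+ 2 * th.
have t00 : 0 <= t0 by rewrite !mulr_ge0 ?exprn_ge0 // ltW.
have m0 : (0 < m)%N by rewrite subn_gt0.
apply: (@le_trans _ _ (t0 ^+ m)); last by rewrite -[leRHS]expr1 ler_wiXn2l.
have b1 : 'C(k, m)%:R <= k%:R ^+ m :> R by rewrite -natrX ler_nat bin_le_expn.
have b2 : 'C(w, m)%:R * th ^+ (2 * m) <= (c * k%:R / e) ^+ m.
  apply: le_trans (bin_fact_scaled m); apply: ler_wpM2r; first by rewrite exprn_ge0 // ltW.
  by rewrite ler_nat leq_pmulr // fact_gt0.
rewrite natrM (mulSn 2) addnC exprD.
have -> : 'C(k, m)%:R * 'C(w, m)%:R * (th ^+ (2 * m) * th ^+ m) =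
    ('C(k, m)%:R * th ^+ m) * ('C(w, m)%:R * th ^+ (2 * m)) by ring.
have -> : t0 ^+ m = (k%:R ^+ m * th ^+ m) * (c ^+ k * e * k%:R) ^+ m.
  by rewrite /t0; move: (c ^+ k) => ck; rewrite expr2 !exprMn; ring.
apply: ler_pM.
- by rewrite mulr_ge0 // exprn_ge0 // ltW.
- by rewrite mulr_ge0 // exprn_ge0 // ltW.
- by apply: ler_wpM2r => //; rewrite exprn_ge0 // ltW.
- apply: le_trans b2 _; rewrite lerXn2r ?nnegrE //.
  + by rewrite divr_ge0 ?mulr_ge0 // ltW.
  + by rewrite !mulr_ge0 ?exprn_ge0 // ltW.
  have ck : c <= c ^+ k by rewrite -{1}[c]expr1 ler_weXn2l.
  have : e^-1 <= e by apply: le_trans e1; rewrite invf_le1.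
  move=> h; rewrite mulrAC; apply: ler_wpM2r => //.
  by apply: ler_pM => //; rewrite invr_ge0 ltW.
Qed.

(** The passage from c to c' < c makes up for rounding w and for replacing the
    falling factorial by a power of w - k. *)
Lemma bin_lower_bound : c * (k%:R / e) * th ^- 2 - 1 <= w%:R -> 0 < c' ->
  2 * e <= (c - c') * th ^- 2 ->
  (c' * th ^- 2) ^+ k / (e * k%:R) <= 'C(w, k)%:R.
Proof.
move=> w_ge c'0 big; set Q := th ^- 2 in w_ge big *.
have Q0 : 0 < Q by rewrite invr_gt0 exprn_gt0.
have h : c' * Q * (k%:R / e) <= w%:R - k%:R.
  have ke0 : 0 <= k%:R / e by rewrite divr_ge0 // ltW.
  have := ler_wpM2r ke0 big.
  have -> : 2 * e * (k%:R / e) = 2 * k%:R by field; rewrite gt_eqF.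
  move: w_ge k1; lra.
have base0 : 0 <= c' * Q * (k%:R / e).
  by apply: mulr_ge0; [apply: mulr_ge0; exact: ltW | rewrite divr_ge0 // ltW].
have kw : (k <= w)%N.
  rewrite -(ler_nat R) -subr_ge0; apply: le_trans h.
  exact: base0.
have f0 : 0 < k`!%:R :> R by rewrite ltr0n fact_gt0.
have lower : (c' * Q * (k%:R / e)) ^+ k <= ('C(w, k) * k`!)%:R.
  apply: (@le_trans _ _ ((w - k) ^ k)%:R); last by rewrite ler_nat bin_fact_ge.
  rewrite natrX natrB // lerXn2r ?nnegrE //; last by rewrite subr_ge0 ler_nat.
have kp : 0 < k%:R :> R by rewrite ltr0n.
have K0 : 0 < e * k%:R by rewrite mulr_gt0.
rewrite ler_pdivrMr // -(ler_pM2r (exprn_gt0 k kp)).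
have -> : 'C(w, k)%:R * (e * k%:R) * k%:R ^+ k = 'C(w, k)%:R * (e * k%:R ^+ k.+1).
  by rewrite exprS; ring.
apply: (@le_trans _ _ ('C(w, k)%:R * (k`!%:R * e ^+ k))); last first.
  by apply: ler_wpM2l => //; apply: fact_le_pow.
rewrite mulrA -natrM -ler_pdivrMr ?exprn_gt0 //; apply: le_trans lower.
by rewrite [leRHS]exprMn (expr_div_n k%:R) -[leLHS]mulrA.
Qed.
End Numerics.

(** * The probability of missing a pattern *)

(** Term m+1 of the exponential series already beats k^m. *)
Lemma exp_beats_poly (R : realType) (a C : R) (m : nat) : 1 < a ->
  \forall k \near \oo%classic, C * k%:R ^+ m <= a ^+ k.
Proof.
move=> a1; pose u := ln a; have u0 : 0 < u by rewrite ln_gt0.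
pose D := u ^+ m.+1 / m.+1`!%:R.
have D0 : 0 < D by rewrite divr_gt0 ?exprn_gt0 // ltr0n fact_gt0.
near=> k.
have k_big : C / D <= k%:R by near: k; exact: nbhs_infty_ger.
have -> : a ^+ k = expR (k%:R * u).
  by rewrite expRM_natl lnK // posrE; apply: lt_trans a1.
apply: (@le_trans _ _ ((k%:R * u) ^+ m.+1 / m.+1`!%:R)).
  have -> : (k%:R * u) ^+ m.+1 / m.+1`!%:R = k%:R * D * k%:R ^+ m.
    by rewrite /D exprMn !exprS; ring.
  by apply: ler_wpM2r; rewrite ?exprn_ge0 // -ler_pdivrMr.
apply: le_trans (expR_ge1Dxn m _); last by rewrite mulr_ge0 // ltW.
by rewrite lerDr.
Unshelve. all: end_near.
Qed.

Section Bound.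
Variables (R : realType) (d q k n : nat) (c c' th : R).
Local Notation e := (expR 1 : R).
Hypotheses (d2 : (2 <= d)%N) (q2 : (2 <= q)%N) (k4 : (4 <= k)%N).
Hypotheses (c_ge1 : 1 <= c) (c'_gt0 : 0 < c') (th_gt0 : 0 < th) (th_le1 : th <= 1).
Hypothesis th_q : th ^+ (2 * d) * q%:R ^+ (k ^ d.-1) = 1.
Hypothesis tau_small : k%:R * (c ^+ k * e * k%:R ^+ 2 * th) <= (32 * 2 ^+ d)^-1.
Hypothesis gap : 2 * e <= (c - c') * th ^- 2.
Hypothesis n_big : c * (k%:R / e) * th ^- 2 <= n%:R.
Hypothesis many : 2 * (e * k%:R) ^+ d * (k%:R ^+ d * ln q%:R + k%:R) <= c' ^+ (k * d).

(** Boxes are taken inside the first w coordinates, with w the integer part of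
    c (k / e) Q. By [many], the expected number of boxes carrying a given pattern
    is at least 2 (k^d ln q + k), so that exp(- mu / 2) beats the number of
    patterns by a factor exp(k). *)
Lemma nonuniversal_bound :
  #|[pred A : darray q (fun _ : 'I_d => n) | ~~ `[< universal k A >]]|%:R <=
    expR (- k%:R) * q%:R ^+ (n ^ d) :> R.
Proof.
have k_gt0 : (0 < k)%N by apply: leq_trans k4.
have q_gt0 : (0 < q)%N by apply: leq_trans q2.
have e0 : 0 < e by exact: expR_gt0.
have k0 : 0 < k%:R :> R by rewrite ltr0n.
have Q0 : 0 < th ^- 2 by rewrite invr_gt0 exprn_gt0.
pose X := c * (k%:R / e) * th ^- 2.
have c0 : 0 <= c by apply: le_trans c_ge1.
have X0 : 0 <= X by apply: mulr_ge0; [rewrite mulr_ge0 ?divr_ge0 // ltW | exact: ltW].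
pose w := Num.truncn X.
have w_le : w%:R <= X by rewrite truncn_le.
have w_ge : X - 1 <= w%:R by rewrite lerBlDr natr1 ltW // truncnS_gt.
have wn : (w <= n)%N by rewrite -(ler_nat R); apply: le_trans w_le n_big.
pose W : {set 'I_n} := [set widen_ord wn x | x : 'I_w].
have cW : #|W| = w.
  rewrite card_imset; first exact: card_ord.
  by move=> x y /(congr1 val) /= xy; apply: val_inj.
pose t0 := c ^+ k * e * k%:R ^+ 2 * th.
have t00 : 0 <= t0.
  by rewrite /t0 !mulr_ge0 ?exprn_ge0 // ltW.
have tau1 : k%:R * t0 <= 1.
  apply: le_trans tau_small _; rewrite invf_le1 ?mulr_gt0 ?exprn_gt0 //.
  have : 1 <= 2 ^+ d :> R by rewrite exprn_ege1 // ler1n.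
  lra.
have small : t0 <= 1.
  by apply: le_trans tau1; rewrite -[leLHS]mul1r ler_wpM2r // ler1n.
have t0k : k%:R * t0 / k%:R = t0 by rewrite mulrC mulKf ?gt_eqF.
have qk : 16 <= q%:R ^+ (k ^ d) :> R.
  rewrite -natrX ler_nat; apply: (@leq_trans (2 ^ 4)) => //.
  apply: (@leq_trans (q ^ 4)); first by rewrite leq_exp2r.
  rewrite leq_exp2l //; apply: leq_trans k4 _.
  by rewrite -{1}(expn1 k) leq_pexp2l // ltnW.
have p0 : 0 < q%:R ^+ (k ^ d) :> R by apply: lt_le_trans qk.
have p16 : q%:R ^- (k ^ d) <= 1 / 16 :> R by rewrite mul1r lef_pV2 ?posrE.
apply: le_trans (@few_nonuniversal d q n k W q_gt0 k_gt0 R p16 _) _.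
  move=> S; apply: (@overlap_sum R d q n k W th (k%:R * t0)) => //.
  - by rewrite mulr_ge0 // ltW.
  - by move=> l lk; rewrite cW t0k; apply: small_overlap_bound.
  - by move=> l lk; rewrite cW t0k; apply: large_overlap_bound.
rewrite cW; apply: ler_wpM2r; first by rewrite exprn_ge0.
set p := q%:R ^- (k ^ d) in p16 *; set N := ('C(w, k) ^ d)%N.
have pp0 : 0 < p by rewrite invr_gt0.
have step1 : (1 - p / 2) ^+ N <= expR (- (p / 2 * N%:R)).
  rewrite (_ : - (p / 2 * N%:R) = N%:R * - (p / 2)); last by ring.
  rewrite expRM_natl lerXn2r ?nnegrE ?expR_ge0 ?expR_ge1Dx //.
  lra.
have step2 : c' ^+ (k * d) / (e * k%:R) ^+ d <= p * N%:R.
  have low := bin_lower_bound k_gt0 th_gt0 w_ge c'_gt0 gap.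
  have : ((c' * th ^- 2) ^+ k / (e * k%:R)) ^+ d <= N%:R.
    rewrite natrX lerXn2r ?nnegrE //; apply: divr_ge0; last by rewrite mulr_ge0 // ltW.
    by rewrite exprn_ge0 // mulr_ge0 // ltW.
  have -> : ((c' * th ^- 2) ^+ k / (e * k%:R)) ^+ d =
      c' ^+ (k * d) / (e * k%:R) ^+ d / p.
    have kd : (k ^ d = k ^ d.-1 * k)%N by rewrite -expnSr prednK // ltnW.
    have thq : th ^+ 2 ^+ (k * d) * q%:R ^+ (k ^ d) = 1.
      rewrite kd (exprM _ (k ^ d.-1) k) (mulnC k d) [_ ^+ (d * k)]exprM -[X in X ^+ k * _]exprM.
      by rewrite -exprMn th_q expr1n.
    have -> : p = (th ^+ 2) ^+ (k * d).
      by rewrite /p -[RHS](mulfK (lt0r_neq0 p0)) thq mul1r.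
    by rewrite (expr_div_n _ (e * k%:R)) -[X in X / _ = _]exprM (expr_div_n c') mulrAC.
  by rewrite ler_pdivrMr // [p * _]mulrC.
have qE : q%:R ^+ (k ^ d) = expR (k%:R ^+ d * ln q%:R) :> R.
  rewrite (_ : k%:R ^+ d = (k ^ d)%:R); last by rewrite natrX.
  by rewrite expRM_natl lnK // posrE ltr0n.
rewrite qE; apply: le_trans (ler_wpM2l (expR_ge0 _) step1) _.
rewrite -expRD ler_expR.
have : 2 * (k%:R ^+ d * ln q%:R + k%:R) <= p * N%:R.
  apply: le_trans step2; rewrite ler_pdivlMr ?exprn_gt0 ?mulr_gt0 //.
  by rewrite mulrAC.
lra.
Qed.
End Bound.

Local Open Scope classical_set_scope.
Local Open Scope ring_scope.

Theorem theorem3 (R : realType) (d q : nat) (hd : (2 <= d)%N) (hq : (2 <= q)%N)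
    (eps : R) (heps : 0 < eps) :
  (fun k : nat =>
     uniform_pr R
       (fun A : darray_of_order d q (threshold_order d q eps k) =>
          universal k A))
    @ \oo --> (1 : R).
Proof.
have e0 : 0 < expR 1 :> R by exact: expR_gt0.
have d0 : 0 < d%:R :> R by rewrite ltr0n ltnW.
have ln2 : 0 < ln 2 :> R by rewrite ln_gt0 // ltr1n.
have q0 : 0 < q%:R :> R by rewrite ltr0n ltnW.
(* b^(2 k) <= th^-1 for all k, so that c <= b leaves room for polynomials in k
   in c^k th; any c' strictly between 1 and c keeps mu exponentially large. *)
pose b : R := expR (ln 2 / (4 * d%:R)).
have b1 : 1 < b by rewrite expR_gt1 divr_gt0 // mulr_gt0.
pose c := Num.min (1 + eps) b.
have c1 : 1 < c by rewrite lt_min b1 andbT; lra.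
pose c' := (1 + c) / 2.
have c0 : 0 <= c by rewrite ltW // (lt_trans _ c1).
have c'1 : 1 < c' by rewrite /c'; lra.
have cc' : 0 < c - c' by rewrite /c'; lra.
have lq0 : 0 <= ln q%:R :> R by rewrite ln_ge0 // ler1n ltnW.
apply: (@squeeze_cvgr _ _ _ _ (fun k => 1 - (expR (-1) : R) ^+ k) (fun=> 1)); last 2 first.
- rewrite -[X in _ --> X]subr0; apply: cvgB; first exact: cvg_cst.
  apply: cvg_expr; rewrite ger0_norm ?expR_ge0 // expR_lt1; lra.
- exact: cvg_cst.
near=> k.
set n := threshold_order d q eps k.
have cardT : #|darray_of_order d q n|%:R = q%:R ^+ (n ^ d) :> R.
  rewrite card_ffun card_ord card_dep_ffun foldrE big_map big_enum /=.
  by rewrite prod_nat_const !card_ord natrX.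
have cardT0 : 0 < q%:R ^+ (n ^ d) :> R by rewrite exprn_gt0.
rewrite /uniform_pr cardT; apply/andP; split; last first.
  by rewrite ler_pdivrMr // mul1r -cardT ler_nat max_card.
rewrite ler_pdivlMr // mulrBl mul1r lerBlDr -cardT.
have k4 : (4 <= k)%N by near: k; exact: nbhs_infty_ge.
have k_gt0 : (0 < k)%N by apply: leq_trans k4.
have f1 : 32 * 2 ^+ d * expR 1 * k%:R ^+ 3 <= b ^+ k by near: k; exact: exp_beats_poly.
have f2 : 2 * expR 1 / (c - c') * k%:R ^+ 0 <= b ^+ k by near: k; exact: exp_beats_poly.
have f3 : 2 * expR 1 ^+ d * (ln q%:R + 1) * k%:R ^+ (2 * d) <= c' ^+ k.
  by near: k; exact: exp_beats_poly.
(* th is the inverse square root of q^(k^(d-1)/d) *)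
pose th : R := expR (- (k%:R ^+ d.-1 * ln q%:R / (2 * d%:R))).
have th0 : 0 < th by exact: expR_gt0.
have bk0 : 0 < b ^+ k by rewrite exprn_gt0 // (lt_trans _ b1).
have qE : q%:R = expR (ln q%:R) :> R by rewrite lnK // posrE.
have th_le1 : th <= 1.
  by rewrite -[leRHS]expR0 ler_expR oppr_le0 divr_ge0 // mulr_ge0 // exprn_ge0.
have th_b : b ^+ k * (b ^+ k * th) <= 1.
  have -> : b ^+ k * (b ^+ k * th) = expR (k%:R * ln 2 / (2 * d%:R)) * th.
    rewrite mulrA -expr2 -exprM -expRM_natl natrM; congr (expR _ * _).
    by field; exact: lt0r_neq0.
  rewrite -expRD -[leRHS]expR0 ler_expR.
  have h : k%:R * ln 2 <= k%:R ^+ d.-1 * ln q%:R :> R.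
    apply: ler_pM => //; first exact: ltW.
      by rewrite -[leLHS]expr1 ler_weXn2l ?ler1n // -ltnS prednK // ltnW.
    by rewrite ler_ln ?posrE // ler_nat.
  by rewrite subr_le0; apply: ler_wpM2r => //.
have bound : #|[pred A : darray q (fun _ : 'I_d => n) | ~~ `[< universal k A >]]|%:R <=
    expR (- k%:R) * q%:R ^+ (n ^ d) :> R.
  apply: (@nonuniversal_bound R d q k n c c' th) => //.
  - exact: ltW.
  - exact: lt_trans ltr01 c'1.
  - rewrite qE -!expRM_natl -expRD -[RHS]expR0; congr expR.
    by rewrite natrM natrX; field; exact: lt0r_neq0.
  - rewrite -[leRHS]mul1r ler_pdivlMr ?mulr_gt0 ?exprn_gt0 //.
    have -> : k%:R * (c ^+ k * expR 1 * k%:R ^+ 2 * th) * (32 * 2 ^+ d) =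
        32 * 2 ^+ d * expR 1 * k%:R ^+ 3 * (c ^+ k * th) by ring.
    apply: le_trans th_b; apply: ler_pM => //.
    + by apply: mulr_ge0; [exact: exprn_ge0 | exact: ltW].
    + apply: ler_wpM2r; first exact: ltW.
      rewrite lerXn2r ?nnegrE //; first by rewrite ltW // (lt_trans _ b1).
      by rewrite ge_min lexx orbT.
  - rewrite [leRHS]mulrC -ler_pdivrMr //; apply: (@le_trans _ _ (b ^+ k)).
      by move: f2; rewrite expr0 mulr1.
    rewrite -[leRHS]div1r ler_pdivlMr ?exprn_gt0 // expr2; apply: le_trans th_b.
    apply: ler_wpM2l; first exact: ltW.
    apply: ler_wpM2r; first exact: ltW.
    by apply: le_trans th_le1 _; apply: exprn_ege1; exact: ltW.
  - rewrite /n /threshold_order natr_absz.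
    have -> : th ^- 2 = q%:R `^ ((k ^ d.-1)%:R / d%:R).
      rewrite /powR gt_eqF // -expRM_natl -expRN natrX; congr expR.
      by field; exact: lt0r_neq0.
    set X := (X in Num.ceil X); apply: (@le_trans _ _ X).
      apply: ler_wpM2r; first exact: powR_ge0.
      by apply: ler_wpM2r; [rewrite divr_ge0 // ltW | rewrite ge_min lexx].
    apply: le_trans (Num.Theory.ceil_ge X) _; rewrite ler_int; exact: ler_norm.
  - apply: (@le_trans _ _ (c' ^+ k)); last first.
      by rewrite ler_weXn2l ?(ltW c'1) // leq_pmulr // ltnW.
    apply: le_trans f3.
    have -> : 2 * (expR 1 * k%:R) ^+ d * (k%:R ^+ d * ln q%:R + k%:R) =
      2 * expR 1 ^+ d * (k%:R ^+ d * (k%:R ^+ d * ln q%:R + k%:R)) :> R.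
      by rewrite exprMn; ring.
    have -> : 2 * expR 1 ^+ d * (ln q%:R + 1) * k%:R ^+ (2 * d) =
      2 * expR 1 ^+ d * (k%:R ^+ d * (k%:R ^+ d * (ln q%:R + 1))) :> R.
      by rewrite mul2n -addnn exprD; ring.
    apply: ler_wpM2l; first by rewrite mulr_ge0 // exprn_ge0 // ltW.
    apply: ler_wpM2l; first exact: exprn_ge0.
    rewrite mulrDr lerD2l mulr1 -[leLHS]expr1 ler_weXn2l ?ler1n //.
    exact: ltnW.
pose good := [pred x : darray_of_order d q n | `[< universal k x >]].
apply: (@le_trans _ _ (#|good|%:R + #|[predC good]|%:R)).
  by rewrite -natrD ler_nat cardC.
rewrite lerD2l; apply: le_trans bound _.
by rewrite -cardT -expRM_natl mulrN1.
Unshelve. all: end_near.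
Qed.
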